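(* For every LCL problem on the class of paths, cycles, trees, or general graphs, the deterministic mending volume $\mathsf{DMVol}$ is asymptotically equivalent to $|N_{\mathsf{MRad}}|$.
   Context: All graphs have maximum degree bounded by a constant. An LCL problem $\Pi=(\Sigma,\mathcal G,\phi)$ consists of a finite label set $\Sigma$, a class $\mathcal G$ of input graphs, and a local verifier $\phi$ of constant radius $r$: $\phi(G,\lambda,v)\in\{\text{happy},\text{unhappy}\}$ depends only on the isomorphism type of the labeled radius-$r$ neighborhood of $v$. A partial solution is a labeling $\lambda:V(G)\to\Sigma\sqcup\{\bot\}$ such that every vertex with no $\bot$ within distance $r$ is happy. A hole is a vertex labeled $\bot$. A mend of $\lambda$ at a hole $v$ is a partial solution $\lambda'$ with $\lambda'(v)\neq\bot$ and $\lambda'(u)\neq\bot$ whenever $\lambda(u)\ne\bot$. Mends are assumed to always exist. A set $W\subseteq V(G)$ contains a mend of $\lambda$ at $v$ if some mend $\lambda'$ of $\lambda$ at $v$ satisfies $\{u:\lambda'(u)\ne\lambda(u)\}\subseteq W$. A (local) mender $\mathcal M$ assigns to each $(G,\lambda,v)$ a Markov chain $\mathcal M_{G,\lambda,v}$ on subsets of $V(G)$ such that: (progress) $\mathcal M_{G,\lambda,v}(W,W')>0$ implies $W\subseteq W'$; (termination) $\mathcal M_{G,\lambda,v}(W,W)=1$ iff $W$ contains a mend of $\lambda$ at $v$; (locality) $\mathcal M_{G,\lambda,v}(W,\cdot)$ depends only on $W$ and its direct neighborhood. In the exploration model only neighbors of already explored vertices can be newly explored, so states reached from $\{v\}$ are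 connected. $\mathcal F=\mathcal F^{\mathcal M}_{G,\lambda,v}(\{v\})$ is the set of absorbing (final) states reachable from $\{v\}$. Then $\mathsf{DMVol}(\mathcal M,G)=\max_{\lambda,v}\max_{W_F\in\mathcal F}|W_F|$ and $\mathsf{MRad}(\mathcal M,G)=\max_{\lambda,v}\min_{W_F\in\mathcal F}\max_{w\in W_F}\mathrm{dist}(v,w)$. For each such measure $X$: $\Pi$ has $X=O(T)$ if there is a mender $\mathcal M$ with $X(\mathcal M,G_n)=O(T(n))$ on all instances $G_n\in\mathcal G$ of size $n$; $\Pi$ has $X=\Omega(T)$ if for every mender $\mathcal M$ there are instances $G_n$ of size $n$ with $X(\mathcal M,G_n)=\Omega(T(n))$. $|N_{\mathsf{MRad}}|$ is the maximum number of vertices in a neighborhood of radius $\mathsf{MRad}$ (of the optimal mender) in an instance of size $n$. Known facts from earlier work, which may be used: $\mathsf{MRad}$ of an LCL problem is $\Theta(1)$ or $\Theta(n)$ on paths and cycles, and $\Theta(1)$, $\Theta(\log n)$ or $\Theta(n)$ on trees.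
   Formalization: Locality of a mender is required only at states containing no mend, and a mender's conditions only for sets W containing v; required at all W, locality and termination contradict each other (e.g. maximal independent set on paths), so no mender would exist. *)

(* Defs.v *)
From mathcomp Require Import all_boot all_order all_algebra.
From mathcomp Require Import finmap.
From mathcomp Require Import boolp classical_sets reals.
From Stdlib Require Import Relation_Operators.

Set Implicit Arguments.
Unset Strict Implicit.
Unset Printing Implicit Defensive.

Import Order.TTheory GRing.Theory Num.Theory.
Local Open Scope fset_scope.

(* Maximum and minimum of a set of natural numbers.  The value 0 is returned
   when there is none; [nat_max] is only used for sets bounded by the number
   of vertices of a graph. *)
Definition nat_max (A : set nat) : nat :=
  xget 0 (fun m => A m /\ forall k, A k -> k <= m).

Definition nat_min (A : set nat) : nat :=
  xget 0 (fun m => A m /\ forall k, A k -> m <= k).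

(* Finite simple graphs, with vertices named by natural numbers. *)
Record graph := Graph {
  verts : {fset nat};
  adj : rel nat;
  adj_sym : symmetric adj;
  adj_irr : irreflexive adj;
  adj_verts : forall x y, adj x y -> x \in verts
}.

Definition order (G : graph) : nat := #|` verts G|.

Definition walk (G : graph) (u w k : nat) : Prop :=
  exists p, [/\ path (adj G) u p, last u p = w & size p = k].

(* Meaningful when [u] and [w] are in the same connected component. *)
Definition dist (G : graph) (u w : nat) : nat := nat_min (walk G u w).

Definition ball (G : graph) (k u : nat) : {fset nat} :=
  [fset w in verts G | `[< exists2 j, j <= k & walk G u w j >]].

Definition closed_nbhd (G : graph) (W : {fset nat}) : {fset nat} :=
  W `|` [fset y in verts G | `[< exists2 x, x \in W & adj G x y >]].

Definition max_degree_le (D : nat) (G : graph) : Prop :=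
  forall x, x \in verts G -> #|` [fset y in verts G | adj G x y]| <= D.

Definition is_path (G : graph) : Prop :=
  exists s : seq nat,
    [/\ uniq s, 0 < size s, verts G =i s &
        forall i j, i < size s -> j < size s ->
          adj G (nth 0 s i) (nth 0 s j) = (j == i.+1) || (i == j.+1)].

Definition is_cycle (G : graph) : Prop :=
  exists s : seq nat,
    [/\ uniq s, 2 < size s, verts G =i s &
        forall i j, i < size s -> j < size s ->
          adj G (nth 0 s i) (nth 0 s j) =
            (j == i.+1 %% size s) || (i == j.+1 %% size s)].

Definition connected (G : graph) : Prop :=
  forall x y, x \in verts G -> y \in verts G -> exists k, walk G x y k.

Definition acyclic (G : graph) : Prop :=
  forall s : seq nat, 2 < size s -> uniq s -> ~~ cycle (adj G) s.

Definition is_tree (G : graph) : Prop :=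
  [/\ verts G != fset0, connected G & acyclic G].

(* The four graph classes; the parameter is the constant bounding the maximum
   degree, which is automatic for paths and cycles. *)
Variant graph_family := Paths | Cycles | Trees of nat | General of nat.

Definition in_family (F : graph_family) (G : graph) : Prop :=
  match F with
  | Paths => is_path G
  | Cycles => is_cycle G
  | Trees D => is_tree G /\ max_degree_le D G
  | General D => max_degree_le D G
  end.

(* [None] is the label of a hole.  The values of a labeling of [G] outside
   [verts G] are irrelevant. *)
Definition labeling (S : Type) := nat -> option S.

(* The labeled radius-[r] neighborhoods of [v1] and [v2], as induced labeled
   subgraphs with a distinguished center, are isomorphic. *)
Definition ball_iso (S : Type) (r : nat)
    (G1 : graph) (l1 : labeling S) (v1 : nat)
    (G2 : graph) (l2 : labeling S) (v2 : nat) : Prop :=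
  exists f : nat -> nat,
    [/\ {in ball G1 r v1 &, injective f},
        [fset f x | x in ball G1 r v1] = ball G2 r v2,
        f v1 = v2,
        {in ball G1 r v1 &, forall x y, adj G2 (f x) (f y) = adj G1 x y} &
        {in ball G1 r v1, forall x, l2 (f x) = l1 x}].

Record lcl := LCL {
  label : finType;
  lclass : graph -> Prop;
  radius : nat;
  happy : graph -> labeling label -> nat -> bool;
  happy_local : forall G1 l1 v1 G2 l2 v2,
    v1 \in verts G1 -> v2 \in verts G2 ->
    ball_iso radius G1 l1 v1 G2 l2 v2 -> happy G1 l1 v1 = happy G2 l2 v2
}.

Section Mending.
Variable P : lcl.

Notation lab := (labeling (label P)).

Definition partial_solution (G : graph) (l : lab) : Prop :=
  forall v, v \in verts G ->
    (forall u, u \in ball G (radius P) v -> l u <> None) -> happy G l v.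

Definition mend (G : graph) (l : lab) (v : nat) (l' : lab) : Prop :=
  [/\ partial_solution G l', l' v <> None &
      forall u, u \in verts G -> l u <> None -> l' u <> None].

Definition contains_mend (G : graph) (l : lab) (v : nat) (W : {fset nat}) :
    Prop :=
  exists2 l', mend G l v l' &
    forall u, u \in verts G -> l' u <> l u -> u \in W.

Definition instance (G : graph) (l : lab) (v : nat) : Prop :=
  [/\ lclass P G, partial_solution G l, v \in verts G & l v = None].

Definition mends_exist : Prop :=
  forall G l v, instance G l v -> exists l', mend G l v l'.

(* States of the chain for the hole [v].  Every set reachable from [{v}]
   contains [v]; sets that do not (such as the empty set) could not satisfy
   termination and exploration together. *)
Definition state (G : graph) (v : nat) (W : {fset nat}) : Prop :=
  v \in W /\ W `<=` verts G.

Variable R : realType.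

(* [M G l v W W'] is the probability of the transition from [W] to [W']. *)
Definition transitions :=
  graph -> lab -> nat -> {fset nat} -> {fset nat} -> R.

Local Open Scope ring_scope.

(* In [mn_local], the two instances agree on [W] and its direct neighborhood.
   Only non-final states are concerned: whether [W] contains a mend can depend
   on vertices at distance up to [2 * radius P] from [W], and if it does then
   [M G l v W] is determined by [mn_termination].  Vertex names are visible to
   the mender: no invariance under renaming is required. *)
Record is_mender (M : transitions) : Prop := IsMender {
  mn_ge0 : forall G l v W W', instance G l v -> state G v W ->
    0 <= M G l v W W';
  mn_sum1 : forall G l v W, instance G l v -> state G v W ->
    \sum_(W' <- fpowerset (verts G)) M G l v W W' = 1;
  mn_progress : forall G l v W W', instance G l v -> state G v W ->
    0 < M G l v W W' -> W `<=` W';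
  mn_exploration : forall G l v W W', instance G l v -> state G v W ->
    0 < M G l v W W' -> W' `<=` closed_nbhd G W;
  mn_termination : forall G l v W, instance G l v -> state G v W ->
    (M G l v W W = 1 <-> contains_mend G l v W);
  mn_local : forall G1 l1 G2 l2 v W,
    instance G1 l1 v -> instance G2 l2 v -> state G1 v W -> state G2 v W ->
    ~ contains_mend G1 l1 v W -> ~ contains_mend G2 l2 v W ->
    closed_nbhd G1 W = closed_nbhd G2 W ->
    {in closed_nbhd G1 W &, forall x y, adj G1 x y = adj G2 x y} ->
    {in closed_nbhd G1 W, forall x, l1 x = l2 x} ->
    forall W', M G1 l1 v W W' = M G2 l2 v W W'
}.

(* The absorbing states reachable from [{v}]. *)
Definition final (M : transitions) (G : graph) (l : lab) (v : nat)
    (W : {fset nat}) : Prop :=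
  clos_refl_trans _ (fun U U' => 0 < M G l v U U') [fset v] W /\
  M G l v W W = 1.

Local Close Scope ring_scope.

Definition DMVol (M : transitions) (G : graph) : nat :=
  nat_max (fun k => exists l v, instance G l v /\
    k = nat_max (fun m => exists2 W, final M G l v W & m = #|` W|)).

Definition MRad (M : transitions) (G : graph) : nat :=
  nat_max (fun k => exists l v, instance G l v /\
    k = nat_min (fun m => exists2 W, final M G l v W &
                            m = \max_(w <- W) dist G v w)).

(* The mending radius, on instances of size [n], of an optimal mender. *)
Definition optMRad (n : nat) : nat :=
  nat_min (fun m => exists2 M, is_mender M &
    m = nat_max (fun k => exists G,
          [/\ lclass P G, order G = n & k = MRad M G])).

(* The quantity |N_MRad|, as a function of the size of the instance. *)
Definition nbhd_MRad (n : nat) : nat :=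
  nat_max (fun k => exists G u,
    [/\ lclass P G, order G = n, u \in verts G &
        k = #|` ball G (optMRad n) u|]).

Local Open Scope ring_scope.

Definition has_bigO (X : transitions -> graph -> nat) (T : nat -> nat) : Prop :=
  exists2 M, is_mender M &
    exists2 C : R, 0 < C & exists n0 : nat, forall n G, (n0 <= n)%N ->
      lclass P G -> order G = n -> (X M G)%:R <= C * (T n)%:R.

(* Only the sizes [n] for which there is an instance are considered. *)
Definition has_bigOmega (X : transitions -> graph -> nat) (T : nat -> nat) :
    Prop :=
  forall M, is_mender M ->
    exists2 c : R, 0 < c & exists n0 : nat, forall n, (n0 <= n)%N ->
      (exists2 G, lclass P G & order G = n) ->
      exists G, [/\ lclass P G, order G = n & c * (T n)%:R <= (X M G)%:R].

Definition has_bigTheta (X : transitions -> graph -> nat) (T : nat -> nat) :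
    Prop :=
  has_bigO X T /\ has_bigOmega X T.

End Mending.

(* Main.v *)
Require Import Defs.
From mathcomp Require Import all_boot all_order all_algebra.
From mathcomp Require Import reals.
From mathcomp Require Import finmap boolp classical_sets.
From mathcomp Require Import zify.
From Stdlib Require Import Relation_Operators Operators_Properties.

Set Implicit Arguments.
Unset Strict Implicit.
Unset Printing Implicit Defensive.

Import Order.TTheory GRing.Theory Num.Theory.
Local Open Scope fset_scope.

(**
Upper bound: breadth-first search is optimal for MRad, because a final state W
of any mender lies in the ball of radius ecc(W) around the hole, and that ball
then contains a mend.  So breadth-first search stops inside a ball of radius
MRad.

Lower bound: a final state of radius T is connected, so it has more than T
vertices, which settles paths and cycles, where balls of radius T have at most
2T + 1 vertices.  On trees and general graphs, if MRad is bounded then so are the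
balls.  Otherwise the volume is linear in n: run the mender on an instance that
forces it to explore at least n vertices, and stop at the first step where the
explored set exceeds s = n / C vertices.  Before this step the explored set W
has fewer than s vertices and contains no mend.  Keep only n vertices including
the (3r+1)-neighborhood of W, and turn into holes those outside the
(2r+1)-neighborhood.  Holes do not constrain their surroundings, so this is a
valid instance; a mend within W would also be a mend in the original instance,
so the mender, being local, makes the same steps and explores at least s
vertices.
*)

(** * Extrema of sets of natural numbers *)

Lemma nat_max_spec (A : set nat) (a b : nat) :
  A a -> (forall k, A k -> k <= b) ->
  A (nat_max A) /\ forall k, A k -> k <= nat_max A.
Proof.
move=> Aa ubA; rewrite /nat_max.
apply: (@xgetPex _ 0 (fun m => A m /\ forall k, A k -> k <= m)).
have exA : exists m, `[< A m >] by exists a; apply/asboolP.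
have ub m : `[< A m >] -> m <= b by move/asboolP/ubA.
case: (ex_maxnP exA ub) => m /asboolP Am max_m.
by exists m; split=> // k Ak; apply: max_m; apply/asboolP.
Qed.

(** The empty set is covered too, since its maximum is the default value 0. *)
Lemma nat_max_le (A : set nat) (b : nat) :
  (forall k, A k -> k <= b) -> nat_max A <= b.
Proof.
move=> ubA; case: (pselect (exists a, A a)) => [[a Aa]|nA].
  by have [/ubA] := nat_max_spec Aa ubA.
by rewrite /nat_max xgetPN // => m [Am _]; apply: nA; exists m.
Qed.

Lemma nat_min_spec (A : set nat) (a : nat) :
  A a -> A (nat_min A) /\ forall k, A k -> nat_min A <= k.
Proof.
move=> Aa; rewrite /nat_min.
apply: (@xgetPex _ 0 (fun m => A m /\ forall k, A k -> m <= k)).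
have exA : exists m, `[< A m >] by exists a; apply/asboolP.
case: (ex_minnP exA) => m /asboolP Am min_m.
by exists m; split=> // k Ak; apply: min_m; apply/asboolP.
Qed.

Lemma card_fset_le (B : {fset nat}) (s : seq nat) :
  {subset B <= s} -> #|` B| <= size s.
Proof. by move=> sBs; apply: uniq_leq_size => //; apply: fset_uniq. Qed.

(** * Walks and balls *)

Section Graphs.
Variable G : graph.

Lemma adj_verts2 x y : adj G x y -> y \in verts G.
Proof. by rewrite adj_sym; apply: adj_verts. Qed.

Lemma path_verts u p : u \in verts G -> path (adj G) u p -> last u p \in verts G.
Proof.
elim: p u => //= x p IHp u _ /andP[uGx xGp].
exact: (IHp _ (adj_verts2 uGx)).
Qed.

Lemma in_ballP k u w :
  reflect (w \in verts G /\ exists2 j, j <= k & walk G u w j) (w \in ball G k u).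
Proof.
rewrite /ball !inE /=; apply: (iffP andP) => [[wV /asboolP]|[wV ?]] //.
by split=> //; apply/asboolP.
Qed.

Lemma closed_nbhdP (W : {fset nat}) y :
  reflect (y \in W \/ exists2 x, x \in W & adj G x y) (y \in closed_nbhd G W).
Proof.
rewrite /closed_nbhd !inE /=; apply: (iffP orP) => [[|/andP[_ /asboolP]]|[]].
- by left.
- by right.
- by left.
- move=> [x xW xy]; right; rewrite (adj_verts2 xy); apply/asboolP.
  by exists x.
Qed.

Lemma sub_closed_nbhd W : W `<=` closed_nbhd G W.
Proof. exact: fsubsetUl. Qed.

Lemma closed_nbhdS U W : U `<=` W -> closed_nbhd G U `<=` closed_nbhd G W.
Proof.
move=> /fsubsetP sUW; apply/fsubsetP => y /closed_nbhdP[yU|[x xU xy]].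
  by apply/closed_nbhdP; left; apply: sUW.
by apply/closed_nbhdP; right; exists x => //; apply: sUW.
Qed.

Lemma closed_nbhd_verts W : W `<=` verts G -> closed_nbhd G W `<=` verts G.
Proof.
move=> /fsubsetP sWV; apply/fsubsetP => y /closed_nbhdP[/sWV //|[x _]].
exact: adj_verts2.
Qed.

Lemma ball_verts k u : ball G k u `<=` verts G.
Proof. by apply/fsubsetP => x /in_ballP[]. Qed.

Lemma ball_le j k u : j <= k -> ball G j u `<=` ball G k u.
Proof.
move=> jk; apply/fsubsetP => x /in_ballP[xV [i ij w]].
by apply/in_ballP; split=> //; exists i => //; apply: leq_trans jk.
Qed.

Lemma ball_center k u : u \in verts G -> u \in ball G k u.
Proof. by move=> uV; apply/in_ballP; split=> //; exists 0 => //; exists [::]. Qed.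

Lemma ball0 u : u \in verts G -> ball G 0 u = [fset u].
Proof.
move=> uV; apply/fsetP => x; rewrite in_fset1; apply/idP/eqP => [|->].
  by move=> /in_ballP[_ [j]]; rewrite leqn0 => /eqP-> [[|? ?] []].
exact: ball_center.
Qed.

Lemma ballS k u : u \in verts G -> ball G k.+1 u = closed_nbhd G (ball G k u).
Proof.
move=> uV; apply/fsetP => y; apply/idP/closed_nbhdP.
  case/in_ballP => yV [j jk [p [up uy sp]]].
  elim/last_ind: p up uy sp => [|p x _] up uy sp.
    by left; rewrite -uy; apply: ball_center.
  rewrite last_rcons in uy; subst x.
  rewrite rcons_path in up; case/andP: up => up uy; right.
  exists (last u p) => //; apply/in_ballP; split; first exact: path_verts.
  rewrite size_rcons in sp.
  by exists (size p); [rewrite -ltnS sp | exists p].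
case=> [|[x /in_ballP[xV [j jk [p [up ux sp]]]] xy]].
  by apply/fsubsetP; apply: ball_le.
apply/in_ballP; split; first exact: adj_verts2 xy.
by exists j.+1 => //; exists (rcons p y);
  rewrite rcons_path last_rcons size_rcons ux up sp.
Qed.

Lemma walk_sym u w k : walk G u w k -> walk G w u k.
Proof.
move=> [p [up uw sp]]; exists (rev (belast u p)); split.
- rewrite -uw rev_path (eq_path (e' := adj G)) // => x y; exact: adj_sym.
- case: p {up sp} uw => [|x p] /=; first by move=> ->.
  by rewrite rev_cons last_rcons.
- by rewrite size_rev size_belast.
Qed.

Lemma ball_sym k u w : u \in verts G -> w \in ball G k u -> u \in ball G k w.
Proof.
move=> uV /in_ballP[wV [j jk w_uw]]; apply/in_ballP; split=> //.
by exists j => //; apply: walk_sym.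
Qed.

Lemma walk_trans x y z i j : walk G x y i -> walk G y z j -> walk G x z (i + j)%N.
Proof.
move=> [p [xp py sp]] [q [yq qz sq]]; exists (p ++ q).
by rewrite cat_path last_cat size_cat xp py yq qz sp sq.
Qed.

(** * Iterated neighborhoods and their size under a degree bound *)

Definition nbhd k (W : {fset nat}) := iter k (closed_nbhd G) W.

Lemma sub_nbhd i j W : i <= j -> nbhd i W `<=` nbhd j W.
Proof.
move=> /subnK<-; elim: (j - i) => //= k IHk.
exact: fsubset_trans IHk (sub_closed_nbhd _).
Qed.

Lemma nbhd_verts k W : W `<=` verts G -> nbhd k W `<=` verts G.
Proof. by move=> sWV; elim: k => //= k; apply: closed_nbhd_verts. Qed.

Lemma ball_nbhd k i W x : W `<=` verts G -> x \in nbhd i W ->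
  ball G k x `<=` nbhd (k + i) W.
Proof.
move=> sWV xW; have xV := fsubsetP (nbhd_verts i sWV) _ xW.
elim: k => [|k IHk]; first by rewrite ball0 // fsub1set.
by rewrite ballS // addSn; apply: closed_nbhdS.
Qed.

Lemma card_closed_nbhd D W : max_degree_le D G -> W `<=` verts G ->
  #|` closed_nbhd G W| <= D.+1 * #|` W|.
Proof.
move=> degG /fsubsetP sWV.
(* Each vertex of [W] accounts for itself and at most [D] neighbors. *)
pose nbrs x := x :: [fset y in verts G | adj G x y].
have -> : D.+1 * #|` W| = \sum_(x <- W) D.+1.
  by rewrite big_const_seq count_predT iter_addn_0.
apply: (@leq_trans (size (flatten [seq nbrs x | x <- W]))).
  apply: card_fset_le => y /closed_nbhdP[yW|[x xW xy]].
    by apply/flatten_mapP; exists y => //; rewrite inE eqxx.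
  apply/flatten_mapP; exists x => //; rewrite inE; apply/orP; right.
  by rewrite !inE /= (adj_verts2 xy).
rewrite size_flatten /shape -map_comp sumnE big_map big_seq [leqRHS]big_seq.
by apply: leq_sum => x /sWV xV; rewrite /= ltnS; apply: degG.
Qed.

Lemma card_nbhd D k W : max_degree_le D G -> W `<=` verts G ->
  #|` nbhd k W| <= D.+1 ^ k * #|` W|.
Proof.
move=> degG sWV; elim: k => [|k IHk]; first by rewrite expn0 mul1n.
apply: leq_trans (card_closed_nbhd degG (nbhd_verts k sWV)) _.
by rewrite expnS -mulnA leq_mul2l IHk orbT.
Qed.

(** * Sets connected to a root *)

Definition conn_from v (W : {fset nat}) := forall w, w \in W ->
  exists p, [/\ path (adj G) v p, last v p = w & {subset v :: p <= W}].

Lemma conn_from1 v : conn_from v [fset v].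
Proof.
move=> w /fset1P->; exists [::]; split=> // x.
by rewrite mem_seq1 => /eqP->; apply: fset11.
Qed.

Lemma conn_from_step v U W : conn_from v U -> U `<=` W ->
  W `<=` closed_nbhd G U -> conn_from v W.
Proof.
move=> cU /fsubsetP sUW /fsubsetP sWU w wW.
have lift x : x \in U ->
    exists p, [/\ path (adj G) v p, last v p = x & {subset v :: p <= W}].
  by move=> /cU[p [vp px sp]]; exists p; split=> // z /sp/sUW.
case/closed_nbhdP: (sWU _ wW) => [/lift//|[x /lift[p [vp px sp]] xw]].
exists (rcons p w); split; rewrite ?rcons_path ?last_rcons ?vp ?px //.
move=> z; rewrite -rcons_cons mem_rcons inE => /predU1P[-> //|/sp //].
Qed.

Lemma conn_from_nbhd v k W : conn_from v W -> conn_from v (nbhd k W).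
Proof.
move=> cW; elim: k => //= k /conn_from_step; apply => //.
exact: sub_closed_nbhd.
Qed.

(** A path inside [W] can be shortened to one without repeated vertices; it then has fewer edges
    than [W] has vertices, and bounds the distance. *)
Lemma conn_from_dist v W w : W `<=` verts G -> conn_from v W -> w \in W ->
  w \in ball G (dist G v w) v /\ dist G v w < #|` W|.
Proof.
move=> /fsubsetP sWV cW wW; have [p [vp pw sp]] := cW _ wW.
case/shortenP: vp pw sp => q vq uq sqp qw sp.
have walk_q : walk G v w (size q) by exists q.
have [walk_d min_d] := nat_min_spec walk_q.
split; first by apply/in_ballP; split; [apply: sWV | exists (dist G v w)].
apply: leq_ltn_trans (min_d _ walk_q) _.
apply: (uniq_leq_size (s1 := v :: q)) => // x.
by rewrite inE => /predU1P[->|/sqp xp]; apply: sp; rewrite inE ?eqxx ?xp ?orbT.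
Qed.

(** As long as vertices are missing, some edge leaves the set, and adding its outer end preserves
    connectivity. The induction is on the number of vertices still to be added. *)
Lemma conn_from_extend v W n : connected G -> v \in W -> W `<=` verts G ->
  conn_from v W -> #|` W| <= n <= #|` verts G| ->
  exists A, [/\ W `<=` A, A `<=` verts G, conn_from v A & #|` A| = n].
Proof.
move=> connG vW; move: {2}(n - _) (leqnn (n - #|` W|)) => m.
elim: m W vW => [|m IHm] W vW le_m sWV cW /andP[leWn len].
  exists W; split=> //; apply/eqP; rewrite eqn_leq leWn /=.
  by rewrite -subn_eq0 -leqn0.
have [eqWn|neWn] := eqVneq #|` W| n; first by exists W.
have ltWn : #|` W| < n by rewrite ltn_neqAle neWn.
have [y yV yW] : exists2 y, y \in verts G & y \notin W.
  apply: contrapT => nex; have sVW : verts G `<=` W.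
    apply/fsubsetP => y yV; case: (boolP (y \in W)) => // yW.
    by case: nex; exists y.
  by have := leq_trans ltWn (leq_trans len (fsubset_leq_card sVW)); rewrite ltnn.
(* A walk from [v] to the outside vertex [y] must cross the boundary of [W]; the edge on which it
   first does so is taken. *)
have [x [xW [z [xz zW]]]] : exists x, x \in W /\ exists z, adj G x z /\ z \notin W.
  have [k [p [vp py _]]] := connG v y (fsubsetP sWV _ vW) yV.
  elim: p (v) vW vp py {IHm sWV leWn le_m neWn ltWn cW} => [|a p IHp] u uW /= vp py.
    by rewrite -py uW in yW.
  case/andP: vp => va ap; case: (boolP (a \in W)) => aW; first exact: (IHp a).
  by exists u; split=> //; exists a.
have zW1 : z |` W `<=` closed_nbhd G W.
  apply/fsubsetP => w /fset1UP[->|]; first by apply/closed_nbhdP; right; exists x.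
  exact: fsubsetP (sub_closed_nbhd W) w.
have vzW : v \in z |` W by rewrite !inE vW orbT.
have le_mz : n - #|` z |` W| <= m by rewrite cardfsU1 zW; lia.
have [|||A [sA AV cA cardA]] := IHm _ vzW le_mz.
- exact: fsubset_trans zW1 (closed_nbhd_verts sWV).
- exact: conn_from_step cW (fsubsetU1 _ _) zW1.
- by rewrite cardfsU1 zW add1n ltWn.
by exists A; split=> //; apply: fsubset_trans sA; apply: fsubsetU1.
Qed.

End Graphs.

(** * Induced subgraphs *)

Section Induced.
Variables (G : graph) (A : {fset nat}).
Hypothesis sAV : A `<=` verts G.

Let adjA : rel nat := fun x y => [&& x \in A, y \in A & adj G x y].

Let adjA_sym : symmetric adjA.
Proof. by move=> x y; rewrite /adjA adj_sym andbCA. Qed.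

Let adjA_irr : irreflexive adjA.
Proof. by move=> x; rewrite /adjA adj_irr !andbF. Qed.

Let adjA_verts x y : adjA x y -> x \in A.
Proof. by case/and3P. Qed.

Definition induced := Graph adjA_sym adjA_irr adjA_verts.

Lemma adj_induced : {in A &, adj induced =2 adj G}.
Proof. by move=> x y xA yA; rewrite /= /adjA xA yA. Qed.

Lemma sub_adj_induced : subrel (adj induced) (adj G).
Proof. by move=> x y /and3P[]. Qed.

Lemma closed_nbhd_induced W : closed_nbhd G W `<=` A ->
  closed_nbhd induced W = closed_nbhd G W.
Proof.
move=> /fsubsetP sWA; apply/fsetP => y; apply/closed_nbhdP/closed_nbhdP.
  by case=> [|[x xW /sub_adj_induced xy]]; [left | right; exists x].
case=> [|[x xW xy]]; [by left | right; exists x => //].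
by rewrite adj_induced //; apply: sWA; apply/closed_nbhdP; [left | right; exists x].
Qed.

(** Distances may grow in an induced subgraph, but not here: balls are built layer by layer, and
    each layer lies in [A]. *)
Lemma ball_induced k u : u \in A -> ball G k u `<=` A ->
  ball induced k u = ball G k u.
Proof.
move=> uA; have uV := fsubsetP sAV _ uA.
elim: k => [|k IHk] sbA; first by rewrite !ball0.
rewrite !ballS // in sbA *.
rewrite IHk; first exact: closed_nbhd_induced.
exact: fsubset_trans (sub_closed_nbhd _ _) sbA.
Qed.

Lemma max_degree_induced D : max_degree_le D G -> max_degree_le D induced.
Proof.
move=> degG x xA; apply: leq_trans (degG x (fsubsetP sAV _ xA)).
apply: fsubset_leq_card; apply/fsubsetP => y; rewrite !inE /=.
by case/andP=> yA /sub_adj_induced->; rewrite (fsubsetP sAV).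
Qed.

Lemma is_tree_induced v : v \in A -> conn_from G v A -> is_tree G ->
  is_tree induced.
Proof.
move=> vA cA [_ _ acG]; split.
- by apply/fset0Pn; exists v.
- have from_v x : x \in A -> exists k, walk induced v x k.
    move=> /cA[p [vp px sp]]; exists (size p), p; split=> //.
    elim: p (v) vp sp {px} => //= y p IHp z /andP[zy yp] sp.
    rewrite IHp // => [|w wp]; last by apply: sp; rewrite inE wp orbT.
    by rewrite -[adjA z y]/(adj induced z y) adj_induced ?zy //; apply: sp;
      rewrite !inE eqxx ?orbT.
  move=> x y /from_v[i /walk_sym xv] /from_v[j vy].
  by exists (i + j)%N; apply: walk_trans vy.
- move=> s size_s uniq_s; apply: contra (acG s size_s uniq_s).
  exact: sub_cycle sub_adj_induced s.
Qed.

End Induced.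

(** * Locality of the verifier and patching of labelings *)

Section Mending.
Variable P : lcl.
Notation lab := (labeling (label P)).
Notation r := (radius P).

(** The form of verifier locality in which the isomorphism is the identity. *)
Lemma happy_eq G1 (l1 : lab) G2 (l2 : lab) u :
  u \in verts G1 -> u \in verts G2 -> ball G1 r u = ball G2 r u ->
  {in ball G1 r u &, adj G1 =2 adj G2} -> {in ball G1 r u, l1 =1 l2} ->
  happy G1 l1 u = happy G2 l2 u.
Proof.
move=> u1 u2 eq_ball eq_adj eq_lab; apply: happy_local => //.
exists id; split=> //.
- rewrite eq_ball; apply/fsetP => x.
  apply/imfsetP/idP => [[y yB -> //]|xB]; by exists x.
- by move=> x y xB yB; rewrite eq_adj.
- by move=> x xB; rewrite eq_lab.
Qed.

Lemma contains_mendS G (l : lab) v U W : U `<=` W ->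
  contains_mend G l v U -> contains_mend G l v W.
Proof.
move=> /fsubsetP sUW [l' ml' sl']; exists l' => // u uV neq.
exact/sUW/sl'.
Qed.

Definition patch (W : {fset nat}) (l1 l2 : lab) : lab :=
  fun x => if x \in W then l1 x else l2 x.

(** Such a [W] is a union of components, so every ball lies inside [W] or misses it. Using a mend on
    [W] and the old labels elsewhere therefore creates no conflict. This guarantees that
    breadth-first search never stalls without a mend. *)
Lemma closed_contains_mend G (l : lab) v W : mends_exist P -> instance G l v ->
  state G v W -> closed_nbhd G W = W -> contains_mend G l v W.
Proof.
move=> hmend iG [vW sWV] clW; have [l1 [ps1 v1 keep1]] := hmend _ _ _ iG.
case: iG => _ psl vV lv; exists (patch W l1 l); last first.
  by move=> u uV; rewrite /patch; case: ifP.
split; first 1 last.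
- by rewrite /patch vW.
- by move=> u uV lu; rewrite /patch; case: ifP => // _; apply: keep1.
have nbW k : nbhd G k W = W by elim: k => //= k ->.
have sub_ball u k : u \in W -> ball G k u `<=` W.
  by move=> uW; rewrite -[X in _ `<=` X](nbW (k + 0)%N); apply: ball_nbhd.
move=> u uV full; case: (boolP (u \in W)) => uW.
  have eql : {in ball G r u, patch W l1 l =1 l1}.
    by move=> x /(fsubsetP (sub_ball _ _ uW)) xW; rewrite /patch xW.
  rewrite (happy_eq (G2 := G) (l2 := l1)) //.
  by apply: ps1 => // x xB; rewrite -eql //; apply: full.
have eql : {in ball G r u, patch W l1 l =1 l}.
  move=> x xB; rewrite /patch; case: ifP => // xW; case/negP: uW.
  by apply: (fsubsetP (sub_ball _ r xW)); apply: ball_sym.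
rewrite (happy_eq (G2 := G) (l2 := l)) //.
by apply: psl => // x xB; rewrite -eql //; apply: full.
Qed.

(** * Truncated instances *)

Section Truncation.
Variables (G : graph) (l : lab) (v : nat) (W A : {fset nat}).
Hypotheses (iG : instance G l v) (vW : v \in W) (sWV : W `<=` verts G).
Hypotheses (sAV : A `<=` verts G) (sWA : nbhd G (3 * r).+1 W `<=` A).

Let L := nbhd G (2 * r).+1 W.
Let G' := induced G A.

(** A vertex within [r] of [W] has its ball within [2 * r] of [W], hence in [L]; the extra 1 keeps
    the direct neighborhood of [W] in [L] even when [r] is 0. A further margin [r] places in [A] the
    ball of every vertex of [L]. *)
Definition truncate : lab := fun x => if x \in L then l x else None.

Let sub_A k : k <= (3 * r).+1 -> nbhd G k W `<=` A.
Proof. by move=> k_le; apply: fsubset_trans (sub_nbhd G W k_le) sWA. Qed.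

Let sub_L k : k <= (2 * r).+1 -> nbhd G k W `<=` L.
Proof. exact: sub_nbhd. Qed.

Lemma truncateE : {in L, truncate =1 l}.
Proof. by move=> x xL; rewrite /truncate xL. Qed.

(** A vertex is checked only if its ball has no hole. That ball then lies in [L], where nothing
    differs from [G]. *)
Lemma truncate_partial : partial_solution G' truncate.
Proof.
have [_ psl _ _] := iG; move=> u uA full.
have uV := fsubsetP sAV _ uA.
have in_L x : truncate x <> None -> x \in L by rewrite /truncate; case: ifP.
have uL : u \in L by apply: in_L; apply: full; apply: ball_center.
have sBA : ball G r u `<=` A.
  apply: fsubset_trans (ball_nbhd (i := (2 * r).+1) r sWV uL) _.
  by apply: sub_A; lia.
have eqB : ball G' r u = ball G r u by apply: ball_induced.
rewrite (happy_eq (G2 := G) (l2 := l)) ?eqB //.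
- apply: psl => // x xB; rewrite -truncateE; first by apply: full; rewrite eqB.
  by apply: in_L; apply: full; rewrite eqB.
- by move=> x y /(fsubsetP sBA) xA /(fsubsetP sBA) yA; rewrite adj_induced.
- by move=> x xB; apply: truncateE; apply: in_L; apply: full; rewrite eqB.
Qed.

(** The changes made on [U] are copied to [G]. A vertex whose ball meets [U] has this ball inside
    [L] and sees the same in both graphs; any other vertex sees only the old labels. *)
Lemma contains_mend_truncate U : U `<=` W ->
  contains_mend G' truncate v U -> contains_mend G l v U.
Proof.
move=> sUW [l1 [ps1 v1 keep1] ch1]; have [_ psl vV lv] := iG.
have sWL : W `<=` L by apply: (sub_L (k := 0)).
have sUL := fsubset_trans sUW sWL.
have sLA : L `<=` A by apply: sub_A; lia.
have vA : v \in A by apply/(fsubsetP sLA)/(fsubsetP sWL).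
(* Outside [U] the mend keeps the truncated labels, which on [L] are those of [l]. *)
have eq1 x : x \in L -> patch U l1 l x = l1 x.
  move=> xL; rewrite /patch; case: (boolP (x \in U)) => // xU.
  have xA : x \in verts G' by apply: (fsubsetP sLA).
  apply/eqP; apply: contraNT xU => /eqP neq; apply: ch1 => //.
  by rewrite truncateE // => /esym.
exists (patch U l1 l); last by move=> u uV; rewrite /patch; case: ifP.
split; first 1 last.
- by rewrite eq1 // (fsubsetP sWL).
- move=> u uV lu; rewrite /patch; case: ifP => // uU.
  have uL := fsubsetP sUL _ uU.
  by apply: keep1; [apply: (fsubsetP sLA) | rewrite truncateE].
move=> u uV full.
case: (pselect (exists2 x, x \in ball G r u & x \in U)) => [[x xB xU]|disj].
  have uN : u \in nbhd G (r + 0) W.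
    apply: (fsubsetP (ball_nbhd (i := 0) r sWV (fsubsetP sUW _ xU))).
    exact: ball_sym.
  have sBL : ball G r u `<=` L.
    apply: fsubset_trans (ball_nbhd r sWV uN) _.
    by apply: sub_L; lia.
  have sBA := fsubset_trans sBL sLA.
  have uA : u \in A by apply: (fsubsetP sBA); apply: ball_center.
  have eqB : ball G' r u = ball G r u by apply: ball_induced.
  rewrite -(happy_eq (G1 := G') (l1 := l1)) ?eqB //.
  - apply: ps1 => // y; rewrite eqB => yB.
    by rewrite -eq1; [apply: full | apply: (fsubsetP sBL)].
  - by move=> y z /(fsubsetP sBA) yA /(fsubsetP sBA) zA; rewrite adj_induced.
  - by move=> y /(fsubsetP sBL) yL; rewrite eq1.
have eql : {in ball G r u, patch U l1 l =1 l}.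
  by move=> x xB; rewrite /patch; case: ifP => // xU; case: disj; exists x.
rewrite (happy_eq (G2 := G) (l2 := l)) //.
by apply: psl => // x xB; rewrite -eql //; apply: full.
Qed.

Lemma truncate_instance : lclass P G' -> instance G' truncate v.
Proof.
move=> cG'; have [_ _ vV lv] := iG.
have vL : v \in L by apply: fsubsetP vW; apply: (sub_L (k := 0)).
split=> //; first exact: truncate_partial.
  by apply: fsubsetP vW; apply: (sub_A (k := 0)).
by rewrite truncateE.
Qed.

End Truncation.

(** * Runs of a mender *)

Variable R : realType.
Local Open Scope ring_scope.

Definition reach (M : transitions P R) G (l : lab) v :=
  clos_refl_trans _ (fun U U' => 0 < M G l v U U') [fset v].

Lemma reach_ind (M : transitions P R) G (l : lab) v (Q : {fset nat} -> Prop) :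
  Q [fset v] ->
  (forall U U', reach M G l v U -> Q U -> 0 < M G l v U U' -> Q U') ->
  forall W, reach M G l v W -> Q W.
Proof.
move=> Q1 Qs W rW; have rW1 := clos_rt_rtn1 _ _ _ _ rW.
elim: {rW} rW1 => // U U' UU' rU QU.
by apply: Qs QU UU'; apply: clos_rtn1_rt.
Qed.

Section Mender.
Variable M : transitions P R.
Hypothesis hM : is_mender M.

Section Chain.
Variables (G : graph) (l : lab) (v : nat).
Hypothesis iG : instance G l v.

Lemma reach_state W : reach M G l v W -> state G v W.
Proof.
have [_ _ vV _] := iG; apply: reach_ind W => [|U U' _ sU UU'].
  by split; rewrite ?fset11 ?fsub1set.
have [vU sUV] := sU; split.
  exact: fsubsetP (mn_progress hM iG sU UU') _ vU.
exact: fsubset_trans (mn_exploration hM iG sU UU') (closed_nbhd_verts sUV).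
Qed.

Lemma reach_conn W : reach M G l v W -> conn_from G v W.
Proof.
apply: reach_ind W => [|U U' /reach_state sU cU UU']; first exact: conn_from1.
exact: conn_from_step cU (mn_progress hM iG sU UU')
         (mn_exploration hM iG sU UU').
Qed.

Lemma reach_step W W' : reach M G l v W -> 0 < M G l v W W' -> reach M G l v W'.
Proof. by move=> rW WW'; apply: rt_trans rW _; apply: rt_step. Qed.

Lemma transition_sum W : state G v W ->
  \sum_(W' <- fpowerset (verts G) | W' != W) M G l v W W' = 1 - M G l v W W.
Proof.
move=> sW; have [_ sWV] := sW; rewrite -(mn_sum1 hM iG sW).
rewrite (bigD1_seq W) ?fpowersetE ?fset_uniq //=.
by rewrite [RHS]addrAC subrr add0r.
Qed.

Lemma mender_leaves W : state G v W -> M G l v W W <> 1 ->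
  exists2 W', W' != W & 0 < M G l v W W'.
Proof.
move=> sW nW; apply: contrapT => stay; apply: nW.
apply/eqP; rewrite eq_sym -subr_eq0 -transition_sum //; apply/eqP.
apply: big1 => W' neW; apply/eqP; rewrite eq_le (mn_ge0 hM) // andbT leNgt.
by apply/negP => pos; apply: stay; exists W'.
Qed.

(** A positive probability of moving leaves less than 1 for staying, so [W] is not absorbing. *)
Lemma mender_moving W W' : state G v W -> 0 < M G l v W W' -> W' != W ->
  ~ contains_mend G l v W.
Proof.
move=> sW pos neW /(mn_termination hM iG sW) W1; have [_ sWV] := sW.
have := transition_sum sW; rewrite W1 subrr => /eqP.
rewrite psumr_eq0 => [|U _]; last exact: (mn_ge0 hM).
move=> /allP/(_ W'); rewrite neW fpowersetE /=.
have -> : W' `<=` verts G.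
  exact: fsubset_trans (mn_exploration hM iG sW pos) (closed_nbhd_verts sWV).
by move=> /(_ isT)/eqP W0; rewrite W0 ltxx in pos.
Qed.

(** A state that is not absorbing can move to a strictly larger one, so the induction is on the
    number of unexplored vertices. *)
Lemma final_above W : reach M G l v W -> exists2 W', final M G l v W' & W `<=` W'.
Proof.
move: {2}(#|` verts G| - #|` W|)%N (leqnn (#|` verts G| - #|` W|)) => m.
elim: m W => [|m IHm] W le_m rW; have sW := reach_state rW;
  case: (pselect (M G l v W W = 1)) => [W1|/(mender_leaves sW)[W' neW pos]];
  try by exists W.
- have /reach_state[_ /fsubset_leq_card] := reach_step rW pos.
  have := mn_progress hM iG sW pos.
  move=> sWW'; have /fproper_ltn_card : W `<` W' by rewrite fproperEneq eq_sym neW.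
  lia.
- have rW' := reach_step rW pos; have [_ /fsubset_leq_card] := reach_state rW'.
  have sWW' := mn_progress hM iG sW pos.
  have /fproper_ltn_card ltW : W `<` W' by rewrite fproperEneq eq_sym neW.
  move=> leV; case: (IHm W' _ rW'); first by lia.
  by move=> F fF sF; exists F => //; apply: fsubset_trans sF.
Qed.

Lemma final_exists : exists W, final M G l v W.
Proof. by case: (final_above (rt_refl _ _ _)) => W fW _; exists W. Qed.

Lemma final_mend W : final M G l v W -> contains_mend G l v W.
Proof. by case=> /reach_state sW /(mn_termination hM iG sW). Qed.

Definition ecc (W : {fset nat}) := (\max_(w <- W) dist G v w)%N.

Lemma reach_ecc W : reach M G l v W ->
  W `<=` ball G (ecc W) v /\ (ecc W < #|` W|)%N.
Proof.
move=> rW; have [vW sWV] := reach_state rW; have cW := reach_conn rW; split.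
  apply/fsubsetP => w wW; have [wB _] := conn_from_dist sWV cW wW.
  apply: fsubsetP wB; apply: ball_le.
  by rewrite /ecc (big_rem w) //= leq_maxl.
have W0 : (0 < #|` W|)%N by rewrite cardfs_gt0; apply/fset0Pn; exists v.
rewrite -(prednK W0) ltnS /ecc big_seq; apply/bigmax_leqP_seq => w wW _.
by rewrite -ltnS prednK //; case: (conn_from_dist sWV cW wW).
Qed.

End Chain.


(** * The extrema defining volume and radius are attained *)

Lemma DMVol_ge G (l : lab) v W : instance G l v -> final M G l v W ->
  (#|` W| <= DMVol M G)%N.
Proof.
move=> iG fW.
pose sizes l v m := exists2 W, final M G l v W & m = #|` W|.
have ub l' v' m : instance G l' v' -> sizes l' v' m -> (m <= #|` verts G|)%N.
  move=> iG' [W' [rW' _] ->]; apply: fsubset_leq_card.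
  by case: (reach_state iG' rW').
apply: leq_trans (_ : (nat_max (sizes l v) <= _)%N).
  have [_] := nat_max_spec (ex_intro2 _ _ W fW erefl) (fun m => @ub l v m iG).
  by apply; exists W.
pose vols k := exists l v, instance G l v /\ k = nat_max (sizes l v).
have [||_] := @nat_max_spec vols (nat_max (sizes l v)) #|` verts G|.
- by exists l, v.
- by move=> _ [l' [v' [iG' ->]]]; apply: nat_max_le => m; apply: ub.
- by apply; exists l, v.
Qed.

(** The inner minimum of [MRad]. *)
Definition min_ecc G (l : lab) v :=
  nat_min (fun m => exists2 W, final M G l v W & m = ecc G v W).

Lemma min_eccP G (l : lab) v : instance G l v ->
  (exists2 W, final M G l v W & min_ecc G l v = ecc G v W) /\
  forall W, final M G l v W -> (min_ecc G l v <= ecc G v W)%N.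
Proof.
move=> iG; have [W fW] := final_exists iG.
have [|at_min min_le] := @nat_min_spec
  (fun m => exists2 W, final M G l v W & m = ecc G v W) (ecc G v W).
  by exists W.
by split=> // W' fW'; apply: min_le; exists W'.
Qed.

Lemma min_ecc_le G (l : lab) v : instance G l v ->
  (min_ecc G l v <= #|` verts G|)%N.
Proof.
move=> iG; have [[W [rW _] ->] _] := min_eccP iG.
have [_ /ltnW le_W] := reach_ecc iG rW; have [_ sWV] := reach_state iG rW.
exact: leq_trans le_W (fsubset_leq_card sWV).
Qed.

Lemma MRad_le G : (MRad M G <= #|` verts G|)%N.
Proof. by apply: nat_max_le => _ [l [v [iG ->]]]; apply: min_ecc_le. Qed.

Lemma MRad_spec G (l : lab) v : instance G l v ->
  (min_ecc G l v <= MRad M G)%N /\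
  exists l' v', instance G l' v' /\ MRad M G = min_ecc G l' v'.
Proof.
move=> iG; pose rads k := exists l v, instance G l v /\ k = min_ecc G l v.
have rad_lv : rads (min_ecc G l v) by exists l, v.
have [|[l' [v' [iG' eq']]] max] := nat_max_spec (b := #|` verts G|) rad_lv.
  by move=> _ [l' [v' [iG' ->]]]; apply: min_ecc_le.
by split; [apply: max | exists l', v'].
Qed.

(** The quantity that [optMRad] minimizes over all menders. *)
Definition max_MRad n :=
  nat_max (fun k => exists G, [/\ lclass P G, Defs.order G = n & k = MRad M G]).

Lemma max_MRad_spec G : lclass P G ->
  (MRad M G <= max_MRad (Defs.order G))%N /\
  exists G', [/\ lclass P G', Defs.order G' = Defs.order G &
                 max_MRad (Defs.order G) = MRad M G'].
Proof.
move=> cG; pose rads k :=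
  exists G', [/\ lclass P G', Defs.order G' = Defs.order G & k = MRad M G'].
have rad_G : rads (MRad M G) by exists G.
have [|[G' [cG' oG' eqG']] max] := nat_max_spec (b := Defs.order G) rad_G.
  by move=> _ [G' [_ <- ->]]; apply: MRad_le.
by split; [apply: max | exists G'].
Qed.

(** When all vertices are holes, the verifier has nothing to check. *)
Lemma instance_exists G : lclass P G -> (0 < Defs.order G)%N ->
  exists (l : lab) v, instance G l v.
Proof.
move=> cG; rewrite /Defs.order cardfs_gt0 => /fset0Pn[v vG].
by exists (fun=> None), v; split=> // u uG /(_ u (ball_center _ uG)).
Qed.

Lemma optMRad_le_max n : (optMRad P R n <= max_MRad n)%N.
Proof.
have [|_] := @nat_min_spec (fun m => exists2 M : transitions P R, is_mender M &
  m = nat_max (fun k => exists G,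
        [/\ lclass P G, Defs.order G = n & k = MRad M G])) (max_MRad n).
  by exists M.
by apply; exists M.
Qed.

(** The optimal radius is at most the worst radius of this mender, which is attained by some graph,
    labeling and hole. *)
Lemma hard_instance n : (0 < n)%N ->
  (exists2 G, lclass P G & Defs.order G = n) ->
  exists G (l : lab) v, [/\ Defs.order G = n, instance G l v &
    forall W, final M G l v W -> (optMRad P R n <= ecc G v W)%N].
Proof.
move=> n0 [G0 cG0 oG0]; have [_ [G [cG oG eqG]]] := max_MRad_spec cG0.
rewrite oG0 in oG eqG.
have [|l0 [v0 iG0]] := instance_exists cG; first by rewrite oG.
have [_ [l [v [iG eq_lv]]]] := MRad_spec iG0.
exists G, l, v; split=> // W fW; apply: leq_trans (optMRad_le_max n) _.
by rewrite eqG eq_lv; have [_ le] := min_eccP iG; apply: le.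
Qed.

(** Without graphs of order [n] the maximum of radii would be the default 0, so a positive value
    yields such a graph. *)
Lemma optMRad_gt0 n : (0 < optMRad P R n)%N ->
  (optMRad P R n <= n)%N /\ exists2 G, lclass P G & Defs.order G = n.
Proof.
move=> opt0; split.
  apply: leq_trans (optMRad_le_max n) _.
  by apply: nat_max_le => k [G [_ oG ->]]; rewrite -oG; apply: MRad_le.
apply: contrapT => nG; move: opt0; rewrite ltnNge => /negP; apply.
apply: leq_trans (optMRad_le_max n) _.
by apply: nat_max_le => k [G [cG oG _]]; case: nG; exists G.
Qed.

(** [W] is the last state below the threshold [s] on a run to [Wf]. The run up to the next state is
    replayed in the truncated instance, whatever further vertices [A] contains. *)
Lemma truncated_volume G (l : lab) v Wf s : instance G l v ->
  final M G l v Wf -> (1 < s <= #|` Wf|)%N ->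
  exists W, [/\ state G v W, conn_from G v W, (#|` W| < s)%N &
    forall A, A `<=` verts G -> nbhd G (3 * r).+1 W `<=` A ->
      lclass P (induced G A) -> (s <= DMVol M (induced G A))%N].
Proof.
move=> iG [rWf _] /andP[s1 sWf].
have [W [W' [rW pos ltW leW']]] : exists W W', [/\ reach M G l v W,
    0 < M G l v W W', (#|` W| < s)%N & (s <= #|` W'|)%N].
  pose crossed := exists W W', [/\ reach M G l v W, 0 < M G l v W W',
    (#|` W| < s)%N & (s <= #|` W'|)%N].
  (* Along the run, either the threshold has been crossed or the state is still small; the latter
     fails at [Wf]. *)
  suff [//|] : crossed \/ (#|` Wf| < s)%N by rewrite ltnNge sWf.
  apply: (reach_ind (Q := fun U => crossed \/ (#|` U| < s)%N) _ _ rWf).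
    by right; rewrite cardfs1.
  move=> U U' rU [|ltU] pos; first by left.
  case: (ltnP #|` U'| s) => [|leU']; first by right.
  by left; exists U, U'.
have sW := reach_state iG rW; have [vW sWV] := sW.
have nmW : ~ contains_mend G l v W.
  apply: (mender_moving iG sW pos); apply: contraTneq ltW => <-.
  by rewrite -leqNgt.
exists W; split=> //; first exact: reach_conn rW.
move=> A sAV sWA cA; pose l' := truncate G l W.
have iA : instance (induced G A) l' v by apply: truncate_instance.
have sub_A k : (k <= (3 * r).+1)%N -> nbhd G k W `<=` A.
  by move=> k_le; apply: fsubset_trans (sub_nbhd G W k_le) sWA.
(* Neither instance has a mend inside [U], and both look alike on its direct neighborhood, so
   [mn_local] applies. *)
have same U U' : reach M G l v U -> U `<=` W ->
    M (induced G A) l' v U U' = M G l v U U'.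
  move=> rU sUW; have sU := reach_state iG rU; have [vU sUV] := sU.
  have sU1 : closed_nbhd G U `<=` nbhd G 1 W by apply: closed_nbhdS.
  have sU1A := fsubset_trans sU1 (sub_A 1%N isT).
  have eqU := closed_nbhd_induced sU1A.
  have sUA := fsubset_trans (sub_closed_nbhd G U) sU1A.
  have nmU : ~ contains_mend G l v U by move/(contains_mendS sUW).
  apply: (mn_local hM) => //.
  - by move/(contains_mend_truncate iG vW sWV sAV sWA sUW).
  - rewrite eqU => x y /(fsubsetP sU1A) xA /(fsubsetP sU1A) yA.
    exact: adj_induced.
  - rewrite eqU => x /(fsubsetP sU1) xW; apply: truncateE.
    by apply: fsubsetP xW; apply: sub_nbhd.
(* By progress, all states on the way to a subset of [W] are subsets of [W], so each transition
   carries over. *)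
have rA U : reach M G l v U -> U `<=` W -> reach M (induced G A) l' v U.
  move=> rU; apply: (reach_ind
    (Q := fun U => U `<=` W -> reach M (induced G A) l' v U) _ _ rU).
    by move=> _; apply: rt_refl.
  move=> U1 U2 rU1 IH pos12 sU2.
  have sU1 : U1 `<=` W.
    exact: fsubset_trans (mn_progress hM iG (reach_state iG rU1) pos12) sU2.
  by apply: reach_step (IH sU1) _; rewrite same.
have rW' : reach M (induced G A) l' v W'.
  by apply: reach_step (rA _ rW (fsubset_refl _)) _; rewrite same.
have [F fF sF] := final_above iA rW'.
apply: leq_trans leW' _; apply: leq_trans (fsubset_leq_card sF) _.
exact: DMVol_ge iA fF.
Qed.

End Mender.

(** * Upper bound by breadth-first search *)

Lemma optMRad_mend (M0 : transitions P R) G (l : lab) v : is_mender M0 ->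
  instance G l v ->
  contains_mend G l v (ball G (optMRad P R (Defs.order G)) v).
Proof.
move=> hM0 iG; have cG : lclass P G by case: iG.
(* [M0] shows that menders exist, so some optimal [M] attains the minimum. *)
have [|[M hM eqT] _] := @nat_min_spec (fun m => exists2 M : transitions P R,
  is_mender M & m = max_MRad M (Defs.order G)) (max_MRad M0 (Defs.order G)).
  by exists M0.
have [[W fW eqW] _] := min_eccP hM iG; have [rW _] := fW.
apply: contains_mendS (final_mend hM iG fW).
apply: fsubset_trans (proj1 (reach_ecc hM iG rW)) _.
apply: ball_le; rewrite -eqW; apply: leq_trans (proj1 (MRad_spec hM iG)) _.
rewrite (eqT : optMRad P R _ = _); exact: (proj1 (max_MRad_spec hM cG)).
Qed.

Lemma card_ball_le_nbhd_MRad G u : lclass P G -> u \in verts G ->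
  (#|` ball G (optMRad P R (Defs.order G)) u| <= nbhd_MRad P R (Defs.order G))%N.
Proof.
move=> cG uV; set n := Defs.order G.
have [||_] := @nat_max_spec (fun k => exists G u, [/\ lclass P G,
  Defs.order G = n, u \in verts G & k = #|` ball G (optMRad P R n) u|])
  #|` ball G (optMRad P R n) u| n.
- by exists G, u.
- by move=> _ [H [w [_ <- _ ->]]]; apply: fsubset_leq_card; apply: ball_verts.
- by apply; exists G, u.
Qed.

(** The test for a mend looks beyond the direct neighborhood. This agrees with [mn_local], which
    compares only states where the test fails in both instances. *)
Definition bfs : transitions P R := fun G l v W W' =>
  (W' == if `[< contains_mend G l v W >] then W else closed_nbhd G W)%:R.

Lemma bfs_gt0 G (l : lab) v W W' : 0 < bfs G l v W W' ->
  W' = if `[< contains_mend G l v W >] then W else closed_nbhd G W.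
Proof. by rewrite /bfs ltr0n lt0b => /eqP. Qed.

Lemma bfs_mender : mends_exist P -> is_mender bfs.
Proof.
move=> hmend; split.
- by move=> *; apply: ler0n.
- move=> G l v W iG [vW sWV].
  set W1 := if `[< contains_mend G l v W >] then W else closed_nbhd G W.
  have sW1 : W1 \in fpowerset (verts G).
    by rewrite fpowersetE /W1; case: ifP => // _; apply: closed_nbhd_verts.
  rewrite (bigD1_seq W1) ?fset_uniq //= big1 => [|W' /negPf neW1].
    by rewrite addr0 /bfs eqxx.
  by rewrite /bfs neW1.
- move=> G l v W W' _ _ /bfs_gt0->; case: ifP => // _; exact: sub_closed_nbhd.
- move=> G l v W W' _ _ /bfs_gt0->; case: ifP => // _; exact: sub_closed_nbhd.
- move=> G l v W iG sW; rewrite /bfs; case: asboolP => mW; first by rewrite eqxx.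
  split=> // /eqP; rewrite pnatr_eq1 eqb1 => /eqP clW.
  exact: closed_contains_mend hmend iG sW (esym clW).
- move=> G1 l1 G2 l2 v W _ _ _ _ n1 n2 eqN _ _ W'.
  by rewrite /bfs !asboolF // eqN.
Qed.

Lemma bfs_final G (l : lab) v W : instance G l v -> final bfs G l v W ->
  exists j, W = ball G j v /\
    forall i, (i < j)%N -> ~ contains_mend G l v (ball G i v).
Proof.
move=> [_ _ vV _] [rW _].
apply: (reach_ind (Q := fun W => exists j, W = ball G j v /\
    forall i, (i < j)%N -> ~ contains_mend G l v (ball G i v)) _ _ rW).
  by exists 0%N; rewrite ball0.
move=> U U' _ [j [-> nj]] /bfs_gt0->; case: asboolP => mj; first by exists j.
exists j.+1; rewrite ballS //; split=> // i.
by rewrite ltnS leq_eqVlt => /predU1P[->|/nj].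
Qed.

Lemma bfs_volume G : mends_exist P -> lclass P G ->
  (DMVol bfs G <= nbhd_MRad P R (Defs.order G))%N.
Proof.
move=> hmend cG.
apply: nat_max_le => _ [l [v [iG ->]]]; apply: nat_max_le => _ [W fW ->].
have [_ _ vV _] := iG; have [j [-> nj]] := bfs_final iG fW.
apply: leq_trans (card_ball_le_nbhd_MRad cG vV).
(* The search has failed at every radius below [j], but radius [optMRad] suffices. *)
apply: fsubset_leq_card; apply: ball_le; rewrite leqNgt; apply/negP => /nj.
by apply; apply: optMRad_mend (bfs_mender hmend) iG.
Qed.

(** * Lower bounds *)

Lemma ratio_le (k a b : nat) : (0 < k)%N -> (a <= k * b)%N ->
  k%:R^-1 * a%:R <= b%:R :> R.
Proof. by move=> k0 ab; rewrite ler_pdivrMl ?ltr0n // -natrM ler_nat. Qed.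

Lemma bigOmega_linear_balls :
  (forall G T u, lclass P G -> u \in verts G -> (#|` ball G T u| <= T.*2.+1)%N) ->
  has_bigOmega (@DMVol P R) (nbhd_MRad P R).
Proof.
move=> ballP M hM; exists 2%:R^-1; first by rewrite invr_gt0 ltr0n.
exists 1%N => n n0 exG.
have [G [l [v [oG iG hard]]]] := hard_instance hM n0 exG.
have [cG _ vV _] := iG; exists G; split=> //; apply: ratio_le => //.
have [W fW] := final_exists hM iG; have [rW _] := fW.
have [_ ltW] := reach_ecc hM iG rW.
apply: (@leq_trans (optMRad P R n).*2.+1).
  by apply: nat_max_le => k [H [u [cH _ uH ->]]]; apply: ballP.
have := DMVol_ge hM iG fW; have := hard W fW; lia.
Qed.

(** The extension hypothesis lets a truncated graph be filled up to exactly [n] vertices without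
    leaving the class. *)
Lemma bigOmega_extendable D : (forall G, lclass P G -> max_degree_le D G) ->
  (forall G v W n, lclass P G -> state G v W -> conn_from G v W ->
    (#|` W| <= n <= #|` verts G|)%N -> exists A,
    [/\ W `<=` A, A `<=` verts G, #|` A| = n & lclass P (induced G A)]) ->
  has_bigOmega (@DMVol P R) (nbhd_MRad P R).
Proof.
move=> degP extP M hM.
case: (pselect (exists B, forall n, (optMRad P R n <= B)%N)) => [[B leB]|unb].
  (* Balls of radius at most [B] have at most [D.+1 ^ B] vertices, and final states are nonempty. *)
  have C0 : (0 < D.+1 ^ B)%N by rewrite expn_gt0.
  exists (D.+1 ^ B)%:R^-1; first by rewrite invr_gt0 ltr0n.
  exists 1%N => n n0 exG; have [G [l [v [oG iG _]]]] := hard_instance hM n0 exG.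
  have [cG _ vV _] := iG; exists G; split=> //; apply: ratio_le => //.
  apply: (@leq_trans (D.+1 ^ B * 1)).
    apply: nat_max_le => k [H [u [cH oH uH ->]]].
    have sub1 : [fset u] `<=` verts H by rewrite fsub1set.
    have := card_nbhd B (degP _ cH) sub1; rewrite cardfs1; apply: leq_trans.
    apply: fsubset_leq_card; apply: fsubset_trans (ball_le _ _ (leB n)) _.
    by rewrite -[B in nbhd _ B _]addn0; apply: ball_nbhd; rewrite ?fset11.
  rewrite leq_mul2l; apply/orP; right.
  have [W fW] := final_exists hM iG; have [rW _] := fW.
  have [_ ltW] := reach_ecc hM iG rW; have := DMVol_ge hM iG fW; lia.
(* [C] bounds the growth factor from a set to its [(3 * r).+1]-neighborhood. *)
set C := (D.+1 ^ (3 * r).+1)%N; have C0 : (0 < C)%N by rewrite expn_gt0.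
have C2 : (0 < 2 * C)%N by rewrite muln_gt0.
exists (2 * C)%:R^-1; first by rewrite invr_gt0 ltr0n.
exists (2 * C)%N => n n_ge _; pose s := (n %/ C)%N.
(* This puts the initial singleton below the threshold. *)
have s1 : (1 < s)%N by rewrite leq_divRL.
have sC : (s * C <= n)%N := leq_divM n C.
(* The hard instance is taken at a size [m] whose optimal radius exceeds [n]; then [m] exceeds [n]
   as well, which leaves room to keep [n] vertices. *)
have [m optm] : exists m, (n < optMRad P R m)%N.
  apply: contrapT => nm; apply: unb; exists n => m; rewrite leqNgt.
  by apply/negP => lt_n; apply: nm; exists m.
have opt0 : (0 < optMRad P R m)%N by apply: leq_trans optm.
have [le_m exG] := optMRad_gt0 hM opt0.
have [G [l [v [oG iG hard]]]] := hard_instance hM (leq_trans opt0 le_m) exG.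
have [cG _ _ _] := iG; have [Wf fWf] := final_exists hM iG; have [rWf _] := fWf.
have [_ ltWf] := reach_ecc hM iG rWf.
have sWf : (1 < s <= #|` Wf|)%N.
  rewrite s1 /=; apply: leq_trans (leq_div n C) (ltnW (leq_trans optm _)).
  exact: leq_trans (hard _ fWf) (ltnW ltWf).
have [W [[vW sWV] cW ltW volP]] := truncated_volume hM iG fWf sWf.
have cardN : (#|` nbhd G (3 * r).+1 W| <= n)%N.
  apply: leq_trans (card_nbhd _ (degP _ cG) sWV) _; apply: leq_trans sC.
  by rewrite mulnC leq_mul2r (ltnW ltW) orbT.
have n_le : (n <= #|` verts G|)%N.
  by rewrite -/(Defs.order G) oG (leq_trans (ltnW optm)).
have stN : state G v (nbhd G (3 * r).+1 W).
  split; last exact: nbhd_verts.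
  exact: fsubsetP (sub_nbhd G W (leq0n _)) _ vW.
have cN : conn_from G v (nbhd G (3 * r).+1 W) by apply: conn_from_nbhd.
have [|A [sNA sAV cardA cA]] := extP G v _ n cG stN cN.
  by rewrite cardN.
exists (induced G A); split=> //; apply: ratio_le => //.
apply: (@leq_trans (2 * C * s)); last by rewrite leq_mul2l volP // orbT.
(* Balls have at most [n] vertices, and [n < (s + 1) * C <= 2 * C * s]. *)
apply: (@leq_trans n).
  apply: nat_max_le => k [H [u [_ <- _ ->]]].
  exact: fsubset_leq_card (ball_verts _ _ _).
have := ltn_ceil n C0; rewrite -/s; nia.
Qed.

End Mending.

(** * Balls in paths and cycles *)

Lemma card_ball_cyclic G (s : seq nat) T u : verts G =i s -> u \in verts G ->
  (forall i j, i < size s -> j < size s -> adj G (nth 0 s i) (nth 0 s j) ->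
     (j == i.+1 %% size s) || (i == j.+1 %% size s)) ->
  #|` ball G T u| <= T.*2.+1.
Proof.
move=> eqs uV adjs; set N := size s in adjs *.
have N0 : 0 < N by move: uV; rewrite eqs /N; case: (s).
(* The offset [T * N.-1] is [- T] modulo [N], so [d] ranges over [-T .. T]. *)
pose pos k d := ((index u s + d + k * N.-1) %% N)%N.
suff pos_ball k w : w \in ball G k u -> exists2 d, d <= k.*2 & w = nth 0 s (pos k d).
  rewrite -[T.*2.+1](size_iota 0) -(size_map (fun d => nth 0 s (pos T d))).
  apply: card_fset_le => w /pos_ball[d dT ->].
  by apply/mapP; exists d => //; rewrite mem_iota add0n ltnS dT.
elim: k w => [|k IHk] w.
  rewrite ball0 // => /fset1P->; exists 0 => //.
  rewrite /pos mul0n !addn0 modn_small ?nth_index // -?eqs //.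
  by rewrite /N index_mem -eqs.
(* Increasing the radius moves the base point back by one: a vertex at offset [d] gets offset
   [d + 1], its cyclic successor [d + 2] and its predecessor [d]. *)
rewrite ballS // => /closed_nbhdP[/IHk[d dk ->]|[x /IHk[d dk ->]]].
  exists d.+1; first by rewrite doubleS; lia.
  congr (nth 0 s _); rewrite /pos.
  have -> : (index u s + d.+1 + k.+1 * N.-1 = index u s + d + k * N.-1 + N)%N.
    by rewrite mulSn; lia.
  by rewrite modnDr.
move=> xw; have wV := adj_verts2 xw; rewrite eqs in wV.
have lt_w : index w s < N by rewrite /N index_mem.
rewrite -[w](nth_index 0 wV) in xw *.
have lt_pos : pos k d < N by rewrite ltn_pmod.
case/orP: (adjs _ _ lt_pos lt_w xw) => /eqP eqw.
  exists d.+2; first by rewrite doubleS; lia.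
  congr (nth 0 s _); rewrite eqw /pos -addn1 modnDml.
  have -> : (index u s + d.+2 + k.+1 * N.-1 =
             index u s + d + k * N.-1 + 1 + N)%N.
    by rewrite mulSn; lia.
  by rewrite modnDr.
exists d; first by rewrite doubleS; lia.
congr (nth 0 s _).
have -> : pos k.+1 d = ((pos k d + N.-1) %% N)%N.
  by rewrite /pos modnDml; congr (_ %% N); rewrite mulSn; lia.
rewrite eqw modnDml.
have -> : ((index w s).+1 + N.-1 = index w s + N)%N by lia.
by rewrite modnDr modn_small.
Qed.

(** * Conclusion for the four graph classes *)

Lemma fset_extend (W V : {fset nat}) n : W `<=` V -> #|` W| <= n <= #|` V| ->
  exists A, [/\ W `<=` A, A `<=` V & #|` A| = n].
Proof.
move=> sWV /andP[leW leV]; pose t := take (n - #|` W|) (V `\` W).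
have sub_t x : x \in t -> x \in V `\` W by apply: mem_take.
exists (W `|` [fset x in t]); split; first exact: fsubsetUl.
  apply/fsubsetP => x; rewrite !inE => /orP[/(fsubsetP sWV) //|/sub_t].
  by rewrite inE => /andP[].
rewrite cardfsU; have -> : W `&` [fset x in t] = fset0.
  apply/fsetP => x; rewrite !inE; apply/negP => /andP[xW /sub_t].
  by rewrite inE xW.
rewrite cardfs0 card_fseq undup_id ?take_uniq ?fset_uniq // size_take_min.
by rewrite cardfsDS // subn0 (minn_idPl _) ?leq_sub2r // subnKC.
Qed.

Theorem corollaryB3 (R : realType) (F : graph_family) (P : lcl)
    (hclass : forall G : graph, lclass P G <-> in_family F G)
    (hmend : mends_exist P) :
  has_bigTheta (@DMVol P R) (nbhd_MRad P R).
Proof.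
split.
  exists (bfs (P := P) R); first exact: bfs_mender.
  exists 1%R; first exact: ltr01.
  exists 0 => n G _ cG <-; rewrite mul1r ler_nat; exact: bfs_volume.
case: F hclass => [||D|D] hclass.
- apply: bigOmega_linear_balls => G T u /hclass[s [_ s0 eqs adjs]] uV.
  apply: (card_ball_cyclic (s := s)) => // i j ilt jlt; rewrite adjs //.
  (* Edges of a path do not wrap around, so the reduction modulo the size changes nothing. *)
  by case/orP=> /eqP eqij; apply/orP; [left | right]; rewrite -eqij modn_small.
- apply: bigOmega_linear_balls => G T u /hclass[s [_ s0 eqs adjs]] uV.
  by apply: (card_ball_cyclic (s := s)) => // i j ilt jlt; rewrite adjs.
- apply: (@bigOmega_extendable _ _ D) => [G /hclass[]//|].
  move=> G v W n /hclass[tG degG] [vW sWV] cW card_n; have [_ connG _] := tG.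
  (* The kept vertices of a tree must remain connected; in a general graph any superset will do. *)
  have [A [sWA sAV cA cardA]] := conn_from_extend connG vW sWV cW card_n.
  exists A; split=> //; apply/hclass; split; last exact: max_degree_induced.
  by apply: is_tree_induced (fsubsetP sWA _ vW) cA tG.
- apply: (@bigOmega_extendable _ _ D) => [G /hclass //|].
  move=> G v W n /hclass degG [_ sWV] _ card_n.
  have [A [sWA sAV cardA]] := fset_extend sWV card_n.
  by exists A; split=> //; apply/hclass; apply: max_degree_induced.
Qed.
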